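(* Let $(\varphi_1,\dots,\varphi_r)$ be an orthonormal basis (with respect to $\langle\cdot,\cdot\rangle_{\mathscr X}$) of an $r$-dimensional subspace of $\mathscr Y$. Suppose that $\mathcal T(\eta)$ is an isometry of $\mathscr X$ for all $\eta\in\mathcal P$, that the maps $\mathcal T(\cdot)\varphi_i\colon\mathcal P\to\mathscr Y$, $i=1,\dots,r$, are continuously differentiable, that $\mathcal F(\mathcal T(p)\varphi)=\mathcal T(p)\mathcal F(\varphi)$ for all $\varphi\in\mathscr Y$, $p\in\mathcal P$, and that $\mathcal T(0)=\mathrm{Id}_{\mathscr X}$ and $\mathcal T(\tilde p)\mathcal T(p)\varphi=\mathcal T(\tilde p+p)\varphi$ for all $\varphi\in\mathscr X$, $p,\tilde p\in\mathcal P$. Then, for each $t>0$, the phase condition $$D(\tilde v(t))^TM_p(p(t))D(\tilde v(t))\,\dot p(t)=D(\tilde v(t))^T\tilde F_p(p(t),\tilde v(t))$$ is the necessary first-order optimality condition (vanishing of the derivative with respect to $\dot p(t)\in\mathbb R^q$, for fixed $p(t)$ and $\tilde v(t)$) for the optimization problem $$\min_{\dot p(t)}\ \frac12\|\mathscr R(t)\|_{\mathscr X}^2+\frac12\|\dot{\tilde v}(t)\|_2^2,$$ where $$\mathscr R(t)=\sum_{i=1}^r\dot{\tilde v}_i(t)\varphi_i-\mathcal F\Big(\sum_{i=1}^r\tilde v_i(t)\varphi_i\Big)+\sum_{i=1}^r\tilde v_i(t)\,\mathcal T(-p(t))[\mathcal T'(p(t))\varphi_i]\dot p(t)$$ and $\dot{\tilde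 v}(t)$ is given, as a function of $p(t),\tilde v(t),\dot p(t)$, by $$\dot{\tilde v}(t)=\tilde F_{\tilde z}(p(t),\tilde v(t))-N(p(t))D(\tilde v(t))\dot p(t).$$
   Context: $(\mathscr X,\langle\cdot,\cdot\rangle_{\mathscr X})$ is a separable real Hilbert space, $\mathscr Y\subseteq\mathscr X$ a dense subspace, $\mathcal F\colon\mathscr Y\to\mathscr X$. $\mathcal P=\mathbb R^q$ and $\mathcal T\colon\mathcal P\to\mathcal B(\mathscr X)$ (bounded linear operators on $\mathscr X$) with $\mathcal T(\eta)\mathscr Y\subseteq\mathscr Y$ for all $\eta\in\mathcal P$. The derivative of $\mathcal T(\cdot)\varphi_i$ at $p$ is denoted $[\mathcal T'(p)\varphi_i]$ and regarded as a linear map $\mathbb R^q\to\mathscr X$; $e_k$ is the $k$th unit vector of $\mathbb R^q$; $\|\cdot\|_2$ is the Euclidean norm. For $p\in\mathcal P$, $v\in\mathbb R^r$, with indices of $\mathbb R^{rq}$ written as pairs $(i,k)$, $1\le i\le r$, $1\le k\le q$: - $D(v)=v\otimes I_q\in\mathbb R^{rq\times q}$ (Kronecker product); - $N(p)\in\mathbb R^{r\times rq}$ with entry at row $i$, column $(j,k)$ equal to $\langle\mathcal T(p)\varphi_i,[\mathcal T'(p)\varphi_j]e_k\rangle_{\mathscr X}$; - $M_p(p)\in\mathbb R^{rq\times rq}$ with entry at row $(i,k)$, column $(j,l)$ equal to $\langle[\mathcal T'(p)\varphi_i]e_k,[\mathcal T'(p)\varphi_j]e_l\rangle_{\mathscr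 X}$; - $\tilde F_{\tilde z}(p,v)\in\mathbb R^r$ with $i$th entry $\langle\mathcal T(p)\varphi_i,\mathcal F(\sum_jv_j\mathcal T(p)\varphi_j)\rangle_{\mathscr X}$; - $\tilde F_p(p,v)\in\mathbb R^{rq}$ with $(i,k)$th entry $\langle[\mathcal T'(p)\varphi_i]e_k,\mathcal F(\sum_jv_j\mathcal T(p)\varphi_j)\rangle_{\mathscr X}$. Here $p(t)\in\mathcal P$ is the path and $\tilde v(t)=(\tilde v_1(t),\dots,\tilde v_r(t))^T\in\mathbb R^r$ the reduced frozen state at time $t$. *)

(* Defs.v *)
From HB Require Import structures.
From mathcomp Require Export all_boot all_order all_algebra.
From mathcomp Require Export all_classical all_reals all_analysis.
From mathcomp.real_closed Require Export mxtens.

Set Implicit Arguments.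
Unset Strict Implicit.
Unset Printing Implicit Defensive.

Import Order.TTheory GRing.Theory Num.Theory.
Import numFieldNormedType.Exports.
Export numFieldNormedType.Exports.

Local Open Scope classical_set_scope.
Local Open Scope ring_scope.

(* A real Hilbert space is a completeNormedModType X over a realType R together
   with ip : {dot X for idfun} (a symmetric, bilinear, positive definite form)
   satisfying [induces_norm ip]. *)
Definition induces_norm (R : realType) (X : normedModType R)
    (ip : {dot X for idfun}) : Prop :=
  forall x : X, `|x| = Num.sqrt (ip x x).

Definition separable (X : topologicalType) : Prop :=
  exists2 D : set X, countable D & dense D.

Definition orthonormal_basis (R : realType) (X : normedModType R)
    (ip : {dot X for idfun}) (r : nat) (Z : {pred X}) (phi : 'I_r -> X) : Prop :=
  [/\ forall i, phi i \in Z,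
      forall i j, ip (phi i) (phi j) = (i == j)%:R
    & forall z, z \in Z -> exists c : 'I_r -> R, z = \sum_i c i *: phi i].

(* The derivative is continuous for the operator norm. *)
Definition continuously_differentiable (R : realType) (V W : normedModType R)
    (f : V -> W) : Prop :=
  (forall x, differentiable f x) /\
  forall x (e : R), 0 < e ->
    \forall y \near x, forall h : V, `|'d f y h - 'd f x h| <= e * `|h|.

Definition norm2 (R : realType) (n : nat) (u : 'cV[R]_n) : R :=
  Num.sqrt (\sum_i u i 0 ^+ 2).

Section ReducedModel.
Context {R : realType} {X : completeNormedModType R} {q r : nat}.
Variables (ip : {dot X for idfun}) (F : X -> X).
Variables (T : 'cV[R]_q -> {linear X -> X}) (phi : 'I_r -> X).
Implicit Types (p w : 'cV[R]_q) (v : 'cV[R]_r).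

Definition dT p (i : 'I_r) : {linear 'cV[R]_q -> X} :=
  'd (fun eta => T eta (phi i)) p.

Definition unit_vec (k : 'I_q) : 'cV[R]_q := delta_mx k 0.

(* The pair (i, k) indexing R^(rq) is encoded in 'I_(r * q) by mxtens_index,
   the index convention of the Kronecker product tensmx. *)
Definition Dmx v : 'M[R]_(r * q, q) :=
  castmx (erefl (r * q)%N, mul1n q) (tensmx v (1%:M : 'M[R]_q)).

Definition dT_at p (a : 'I_(r * q)) : X :=
  dT p (mxtens_unindex a).1 (unit_vec (mxtens_unindex a).2).

Definition Nmx p : 'M[R]_(r, r * q) :=
  \matrix_(i, a) ip (T p (phi i)) (dT_at p a).

Definition Mpmx p : 'M[R]_(r * q) :=
  \matrix_(a, b) ip (dT_at p a) (dT_at p b).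

Definition Ftilde_z p v : 'cV[R]_r :=
  \col_i ip (T p (phi i)) (F (\sum_j v j 0 *: T p (phi j))).

Definition Ftilde_p p v : 'cV[R]_(r * q) :=
  \col_a ip (dT_at p a) (F (\sum_j v j 0 *: T p (phi j))).

Definition vdot p v w : 'cV[R]_r := Ftilde_z p v - Nmx p *m Dmx v *m w.

Definition residual p v w : X :=
  \sum_i vdot p v w i 0 *: phi i - F (\sum_i v i 0 *: phi i)
  + \sum_i v i 0 *: T (- p) (dT p i w).

Definition objective p v w : R :=
  2^-1 * `|residual p v w| ^+ 2 + 2^-1 * norm2 (vdot p v w) ^+ 2.

Definition phase_condition p v w : Prop :=
  (Dmx v)^T *m Mpmx p *m Dmx v *m w = (Dmx v)^T *m Ftilde_p p v.

End ReducedModel.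

(* Main.v *)
(** Write u_i = T(p) phi_i, g(w) = sum_i v_i [T'(p) phi_i] w and f = F(sum_i v_i u_i).
    The isometry T(p) maps the residual to P(f - g(w)) - (f - g(w)), where P is
    the orthogonal projection onto the span of the u_i, and the reduced velocity
    consists of the coordinates of P(f - g(w)). By Pythagoras the objective is
    therefore |g(w) - f|^2 / 2: a linear least-squares problem whose normal
    equations <g(h), g(w) - f> = 0 are the phase condition. *)

Require Import Defs.
From HB Require Import structures.
From mathcomp Require Import ring lra.

Import Order.TTheory GRing.Theory Num.Theory.
Import numFieldNormedType.Exports.

Set Implicit Arguments.
Unset Strict Implicit.
Unset Printing Implicit Defensive.

Local Open Scope classical_set_scope.
Local Open Scope ring_scope.

(** * Real inner products: bilinearity, isometries, orthogonal projection *)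

Section InnerProduct.
Variables (R : realType) (X : normedModType R) (ip : {dot X for idfun}).

Lemma ip_sym x y : ip x y = ip y x.
Proof. by rewrite hermC /= expr0 mul1r. Qed.

Lemma ip_ge0 x : 0 <= ip x x.
Proof.
have [->|x0] := eqVneq x 0; first by rewrite linear0l.
exact: ltW (neq0_dnorm_gt0 x x0).
Qed.

Lemma ipDl x y z : ip (x + y) z = ip x z + ip y z.
Proof. exact: linearDl. Qed.

Lemma ipDr x y z : ip z (x + y) = ip z x + ip z y.
Proof. exact: linearDr. Qed.

Lemma ipBl x y z : ip (x - y) z = ip x z - ip y z.
Proof. exact: linearBl. Qed.

Lemma ipBr x y z : ip z (x - y) = ip z x - ip z y.
Proof. exact: linearBr. Qed.

Lemma ipZl (a : R) x y : ip (a *: x) y = a * ip x y.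
Proof. exact: linearZl_LR. Qed.

Lemma ipZr (a : R) x y : ip x (a *: y) = a * ip x y.
Proof. by rewrite ip_sym ipZl ip_sym. Qed.

Lemma ip_suml (n : nat) (c : 'I_n -> R) (e : 'I_n -> X) y :
  ip (\sum_i c i *: e i) y = \sum_i c i * ip (e i) y.
Proof. by rewrite linear_sumlz; apply: eq_bigr => i _; exact: ipZl. Qed.

Lemma ip_sumr (n : nat) (c : 'I_n -> R) (e : 'I_n -> X) y :
  ip y (\sum_i c i *: e i) = \sum_i c i * ip y (e i).
Proof. by rewrite ip_sym ip_suml; apply: eq_bigr => i _; rewrite ip_sym. Qed.

Lemma ip_sqrB x y : ip (x - y) (x - y) = ip x x - 2 * ip x y + ip y y.
Proof. by rewrite !ipBl !ipBr (ip_sym y x); ring. Qed.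

Lemma sqr_norm_ip : induces_norm ip -> forall x, `|x| ^+ 2 = ip x x.
Proof. by move=> hip x; rewrite hip sqr_sqrtr ?ip_ge0. Qed.

(** Polarization: in the expansion of the squared norm of [x - y], all terms but the cross term are
    already known to be preserved. *)
Lemma isometry_ip (T : {linear X -> X}) : induces_norm ip ->
  (forall x y, `|T x - T y| = `|x - y|) ->
  forall x y, ip (T x) (T y) = ip x y.
Proof.
move=> hip isoT x y.
have sqT z : ip (T z) (T z) = ip z z.
  by rewrite -!sqr_norm_ip// -[T z]subr0 -(linear0 T) isoT subr0.
have := sqT (x - y); rewrite linearB !ip_sqrB !sqT; lra.
Qed.

(* Pythagoras: y is the orthogonal projection of x onto the span of e. *)
Lemma orthonormal_residual (r : nat) (e : 'I_r -> X) :
  (forall i j, ip (e i) (e j) = (i == j)%:R) ->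
  forall x, let y := \sum_i ip (e i) x *: e i in
  ip (y - x) (y - x) + \sum_i ip (e i) x ^+ 2 = ip x x.
Proof.
move=> one x y.
have yx : ip y x = \sum_i ip (e i) x ^+ 2 by rewrite ip_suml.
have yy : ip y y = \sum_i ip (e i) x ^+ 2.
  rewrite {1}/y ip_suml; apply: eq_bigr => i _; rewrite expr2; congr (_ * _).
  rewrite ip_sumr (bigD1 i)//= one eqxx mulr1 big1 ?addr0// => j ji.
  by rewrite one eq_sym (negbTE ji) mulr0.
by rewrite ip_sqrB yx yy; ring.
Qed.

End InnerProduct.

Lemma cVE_sum_unit_vec (R : realType) (q : nat) (w : 'cV[R]_q) :
  w = \sum_k w k 0 *: unit_vec k.
Proof.
by rewrite [LHS]matrix_sum_delta; apply: eq_bigr => k _; rewrite big_ord1.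
Qed.

(** * Linear least squares: derivative and minimizers *)

Section LeastSquares.
Variables (R : realType) (X : normedModType R) (ip : {dot X for idfun}).
Variables (q : nat) (g : {linear 'cV[R]_q -> X}) (f : X).

Definition half_sqdist (w : 'cV[R]_q) : R := 2^-1 * ip (g w - f) (g w - f).

(** This exact quadratic expansion along a line yields both the derivative and the condition at a
    minimizer. *)
Lemma half_sqdist_line w h s :
  half_sqdist (w + s *: h) = half_sqdist w + s * ip (g h) (g w - f)
    + s ^+ 2 * (2^-1 * ip (g h) (g h)).
Proof.
rewrite /half_sqdist (linearD g) (linearZ_LR g) addrAC.
move: (g w - f) (g h) => a b.
rewrite !ipDl !ipDr !ipZl !ipZr (ip_sym ip a b).
by field.
Qed.

(** Continuity of [g] is not assumed: the domain is finite-dimensional, so the functional is a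
    finite combination of coordinates. *)
Lemma linear_ip_differentiable c w :
  differentiable (fun w => ip (g w) c : R) w.
Proof.
have -> : (fun w => ip (g w) c) =
    \sum_k (fun w : 'cV[R]_q => w k 0) * cst (ip (g (unit_vec k)) c).
  apply/funext => w'; rewrite fct_sumE {1}(cVE_sum_unit_vec w') (linear_sum g).
  rewrite linear_sumlz; apply: eq_bigr => k _.
  by rewrite (linearZ_LR g) /= ipZl.
apply: differentiable_sum => k; apply: differentiableM => //.
exact: differentiable_coord.
Qed.

Lemma half_sqdist_differentiable w : differentiable half_sqdist w.
Proof.
(* [Q] is the quadratic term [ip (g w) (g w)] with its second argument expanded in coordinates, a
   sum of products of linear functionals. *)
pose Q : 'cV[R]_q -> R := \sum_k ((fun w : 'cV[R]_q => w k 0) *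
                                   (fun w => ip (g w) (g (unit_vec k)))).
pose L : 'cV[R]_q -> R := fun w => ip (g w) f.
have dQ : differentiable Q w.
  apply: differentiable_sum => k; apply: differentiableM.
    exact: differentiable_coord.
  exact: linear_ip_differentiable.
have dL : differentiable L w by exact: linear_ip_differentiable.
have -> : half_sqdist = cst 2^-1 * (Q + cst (- 2) * L + cst (ip f f)).
  apply/funext => w'; rewrite /half_sqdist ip_sqrB.
  congr (_ * _); rewrite /= /Q fct_sumE.
  rewrite {2}(cVE_sum_unit_vec w') (linear_sum g) linear_sumr.
  congr (_ + _ + _); last by rewrite -mulNr.
  by apply: eq_bigr => k _; rewrite (linearZ_LR g) /= ipZr.
exact: (differentiableM (differentiable_cst _ _) (differentiableD
  (differentiableD dQ (differentiableM (differentiable_cst _ _) dL))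
  (differentiable_cst _ _))).
Qed.

Lemma diff_half_sqdist w h : 'd half_sqdist w h = ip (g h) (g w - f) :> R.
Proof.
rewrite -deriveE; last exact: half_sqdist_differentiable.
apply: cvg_lim => //.
set a := ip (g h) (g w - f); set b := 2^-1 * ip (g h) (g h).
(* For nonzero [s] the difference quotient equals [a + s * b] exactly. *)
apply: (@cvg_trans _ ((a + s * b) @[s --> (0 : R)^'])).
  apply: near_eq_cvg; near=> s.
  rewrite /= (addrC _ w) half_sqdist_line -/a -/b.
  have s0 : s != 0 by near: s; exact: nbhs_dnbhs_neq.
  by rewrite /GRing.scale /=; field.
have a0 : a = a + 0 * b by rewrite mul0r addr0.
rewrite [X in _ `=>` nbhs X]a0.
apply: cvgD; first exact: cvg_cst.
by apply: cvgM; [exact: nbhs_dnbhs | exact: cvg_cst].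
Unshelve. all: by end_near. Qed.

Lemma half_sqdist_min w : (forall w', half_sqdist w <= half_sqdist w') ->
  forall h, ip (g h) (g w - f) = 0.
Proof.
move=> minw h; set a := ip _ _; set b := ip (g h) (g h).
have b0 : 0 <= b by exact: ip_ge0.
have b1 : 0 < b + 1 by lra.
(* The minimizer along the line would be at [- a / b]; using [b + 1] also covers [b = 0] and still
   gives a strict decrease unless [a = 0]. *)
have := minw (w + (- a / (b + 1)) *: h).
rewrite half_sqdist_line -/a -/b -subr_ge0.
have -> : half_sqdist w + - a / (b + 1) * a + (- a / (b + 1)) ^+ 2 * (2^-1 * b)
    - half_sqdist w = - ((a / (b + 1)) ^+ 2 * (b / 2 + 1)).
  by field; lra.
rewrite oppr_ge0 pmulr_lle0; last by lra.
move=> sq0; apply/eqP.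
have : a / (b + 1) == 0 by rewrite -sqrf_eq0 eq_le sq0 sqr_ge0.
by rewrite mulf_eq0 invr_eq0 (gt_eqF b1) orbF.
Qed.

End LeastSquares.

(** * The reduced model as a least-squares problem *)

Section ReducedModelTheory.
Variables (R : realType) (X : completeNormedModType R) (q r : nat).
Variables (ip : {dot X for idfun}) (F : X -> X).
Variables (T : 'cV[R]_q -> {linear X -> X}) (phi : 'I_r -> X).
Variables (p : 'cV[R]_q) (v : 'cV[R]_r).

(** The map g of the overview: the velocity of the lifted state caused by moving [p] in direction
    [w] with [v] frozen. *)
Definition lift_velocity (w : 'cV[R]_q) : X := \sum_i v i 0 *: dT T phi p i w.

Lemma lift_velocity_is_linear : linear lift_velocity.
Proof.
move=> a w w'; rewrite /lift_velocity scaler_sumr -big_split /=.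
by apply: eq_bigr => i _; rewrite linearP scalerDr !scalerA mulrC.
Qed.

HB.instance Definition _ := GRing.isLinear.Build R 'cV[R]_q X _ lift_velocity
  lift_velocity_is_linear.

Lemma DmxE i (k l : 'I_q) : Dmx v (mxtens_index (i, k)) l = v i 0 * (k == l)%:R.
Proof.
rewrite /Dmx castmxE cast_ord_id /=.
(* [v] has a single column, so column [l] of the product is the pair [(0, l)]. *)
have -> : cast_ord (esym (mul1n q)) l = mxtens_index (ord0, l).
  by apply: val_inj.
by rewrite tensmxE mxE.
Qed.

Lemma sum_mxtens_index (V : nmodType) (E : 'I_(r * q) -> V) :
  \sum_a E a = \sum_i \sum_k E (mxtens_index (i, k)).
Proof.
rewrite pair_big /= (reindex (@mxtens_index r q)) /=.
  by apply: eq_bigr => -[].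
by exists (@mxtens_unindex r q) => a _; rewrite (mxtens_indexK, mxtens_unindexK).
Qed.

(** The [(i, k)] entry of [Dmx v *m w] is [v i 0 * w k 0], and linearity of the derivative
    reassembles [w]. All matrix expressions reduce to inner products through this identity. *)
Lemma sum_Dmx_dT_at w :
  \sum_a (Dmx v *m w) a 0 *: dT_at T phi p a = lift_velocity w.
Proof.
rewrite sum_mxtens_index; apply: eq_bigr => i _.
rewrite {2}(cVE_sum_unit_vec w) linear_sum scaler_sumr.
apply: eq_bigr => k _; rewrite linearZ_LR /= scalerA.
rewrite /dT_at mxtens_indexK /=; congr (_ *: _).
rewrite mxE (bigD1 k)//= DmxE eqxx mulr1 big1 ?addr0// => l lk.
by rewrite DmxE eq_sym (negbTE lk) mulr0 mul0r.
Qed.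

Lemma trDmx_mul (c : X) (k : 'I_q) :
  ((Dmx v)^T *m \col_a ip (dT_at T phi p a) c) k 0
  = ip (lift_velocity (unit_vec k)) c.
Proof.
rewrite -sum_Dmx_dT_at ip_suml mxE; apply: eq_bigr => a _.
by rewrite -colE !mxE.
Qed.

Lemma Mpmx_mul w :
  Mpmx ip T phi p *m Dmx v *m w = \col_a ip (dT_at T phi p a) (lift_velocity w).
Proof.
apply/colP => a; rewrite -mulmxA [RHS]mxE -sum_Dmx_dT_at ip_sumr mxE.
by apply: eq_bigr => b _; rewrite mxE mulrC.
Qed.

Lemma Nmx_mul w :
  Nmx ip T phi p *m Dmx v *m w = \col_i ip (T p (phi i)) (lift_velocity w).
Proof.
apply/colP => i; rewrite -mulmxA [RHS]mxE -sum_Dmx_dT_at ip_sumr mxE.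
by apply: eq_bigr => b _; rewrite mxE mulrC.
Qed.

Let f : X := F (\sum_j v j 0 *: T p (phi j)).

Lemma phase_conditionP w : phase_condition ip F T phi p v w <->
  forall h, ip (lift_velocity h) (lift_velocity w - f) = 0.
Proof.
(* Row [k] of the phase condition is the normal equation tested against [unit_vec k]; linearity then
   gives all directions. *)
have -> : phase_condition ip F T phi p v w <->
    forall k, ip (lift_velocity (unit_vec k)) (lift_velocity w - f) = 0.
  rewrite /phase_condition -!(mulmxA (Dmx v)^T) Mpmx_mul -/f.
  split=> [/colP e k|e].
    by rewrite ipBr -!trDmx_mul e subrr.
  by apply/colP => k; rewrite !trDmx_mul; apply/eqP; rewrite -subr_eq0 -ipBr e.
split=> // e h.
rewrite (cVE_sum_unit_vec h) linear_sum linear_sumlz big1// => k _.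
by rewrite linearZ_LR /= ipZl e mulr0.
Qed.

Lemma vdotE w i : vdot ip F T phi p v w i 0 = ip (T p (phi i)) (f - lift_velocity w).
Proof. by rewrite /vdot Nmx_mul !mxE ipBr. Qed.

(* Since T p is an isometry, the residual may be measured after applying T p;
   there it is the part of [lift_velocity w - f] orthogonal to the moved basis,
   while [vdot] collects the remaining coordinates. *)
Lemma objectiveE (hip : induces_norm ip) (Y : {pred X}) (hY : submod_closed Y)
    (phiY : forall i, phi i \in Y)
    (phi1 : forall i j, ip (phi i) (phi j) = (i == j)%:R)
    (isoT : forall eta x y, `|T eta x - T eta y| = `|x - y|)
    (equivF : forall y, y \in Y -> F (T p y) = T p (F y))
    (T0 : forall x, T 0 x = x)
    (TD : forall p' p x, T p' (T p x) = T (p' + p) x) w :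
  objective ip F T phi p v w = half_sqdist ip lift_velocity f w.
Proof.
set x := f - lift_velocity w; set e := fun i => T p (phi i).
have e1 i j : ip (e i) (e j) = (i == j)%:R by rewrite isometry_ip.
(* Equivariance of [F] is assumed on [Y] only, so the reduced state must be placed there. *)
have zY : \sum_i v i 0 *: phi i \in Y.
  have [Y0 YP] := hY; elim/big_ind : _ => [//|y z yY zY|i _].
    by rewrite -[y]scale1r; exact: YP.
  by rewrite -[_ *: _]addr0; exact: YP.
have TpR : T p (residual ip F T phi p v w) = \sum_i ip (e i) x *: e i - x.
  rewrite /residual linearD linearB -equivF// !linear_sum /=.
  rewrite /x opprB [lift_velocity w - f]addrC addrA; congr (_ - _ + _).
  - by apply: eq_bigr => i _; rewrite linearZ_LR vdotE.
  - by rewrite /f; congr F; apply: eq_bigr => i _; rewrite linearZ_LR.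
  (* The group law cancels [T p] against [T (- p)]. *)
  - by apply: eq_bigr => i _; rewrite linearZ_LR /= TD subrr T0.
rewrite /objective /norm2 sqr_sqrtr; last by apply: sumr_ge0 => i _; rewrite sqr_ge0.
rewrite (sqr_norm_ip hip) -(isometry_ip hip (isoT p)) TpR -mulrDr /half_sqdist.
under [X in _ + X]eq_bigr => i _ do rewrite vdotE.
(* Pythagoras leaves [ip x x], where [x] is the least-squares residual up to sign. *)
by rewrite orthonormal_residual// -(hnormN ip x) /x opprB.
Qed.

End ReducedModelTheory.

Theorem theorem6p5 (R : realType) (X : completeNormedModType R)
    (ip : {dot X for idfun}) (hip : induces_norm ip) (hsep : separable X)
    (Y : {pred X}) (hY : submod_closed Y) (hYdense : dense [set` Y])
    (* the values of F outside Y are irrelevant *)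
    (F : X -> X) (q r : nat)
    (T : 'cV[R]_q -> {linear X -> X})
    (hTbounded : forall eta, bounded_near (T eta) (nbhs (0 : X)))
    (hTY : forall eta y, y \in Y -> T eta y \in Y)
    (Z : {pred X}) (hZ : submod_closed Z) (hZY : {subset Z <= Y})
    (phi : 'I_r -> X) (hphi : orthonormal_basis ip Z phi)
    (hTisom : forall eta x y, `|T eta x - T eta y| = `|x - y|)
    (hTC1 : forall i, continuously_differentiable (fun eta => T eta (phi i)))
    (hFequiv : forall p y, y \in Y -> F (T p y) = T p (F y))
    (hT0 : forall x, T 0 x = x)
    (hTadd : forall p' p x, T p' (T p x) = T (p' + p) x)
    (p : R -> 'cV[R]_q) (v : R -> 'cV[R]_r) (t : R) (ht : 0 < t) :
  let J := objective ip F T phi (p t) (v t) in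
  (forall w : 'cV[R]_q,
     differentiable J w /\
     ('d J w = (fun=> 0) :> ('cV[R]_q -> R) <->
      phase_condition ip F T phi (p t) (v t) w)) /\
  (forall w : 'cV[R]_q, (forall w', J w <= J w') ->
     phase_condition ip F T phi (p t) (v t) w).
Proof.
move=> J; have [phiZ phi1 _] := hphi.
(* In least-squares form, both claims follow from the normal equations. *)
have -> : J = half_sqdist ip (lift_velocity T phi (p t) (v t))
    (F (\sum_j v t j 0 *: T (p t) (phi j))).
  apply/funext => w; rewrite /J (objectiveE _ hip hY) // => [i|y yY].
    exact: hZY.
  exact: hFequiv.
split=> [w|w minw]; last first.
  by apply/phase_conditionP; exact: half_sqdist_min minw.
split; first exact: half_sqdist_differentiable.
rewrite phase_conditionP; split=> [d0 h|d0].
  by rewrite -diff_half_sqdist d0.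
by apply/funext => h; rewrite diff_half_sqdist d0.
Qed.
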